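(* Consider the homogeneous \texttt{MCM} algorithm described in the context, and assume (A1), (A2), (A4). If $\gamma\le(8\omega_{\mathrm{dwn}}L)^{-1}$ and $\alpha_{\mathrm{dwn}}\le(8\omega_{\mathrm{dwn}})^{-1}$, then for all $k\ge1$, $$\mathbb{E}[\Upsilon_k]\le\Big(1-\frac{\alpha_{\mathrm{dwn}}}{2}\Big)\mathbb{E}[\Upsilon_{k-1}]+2\gamma^2\Big(\frac1{\alpha_{\mathrm{dwn}}}+\frac{\omega_{\mathrm{up}}}{N}\Big)\mathbb{E}\|\nabla F(\widehat w_{k-1})\|^2+\frac{2\gamma^2\sigma^2(1+\omega_{\mathrm{up}})}{Nb}.$$
   Context: Distributed setting with $N\ge1$ workers, objective $F:\mathbb{R}^d\to\mathbb{R}$; workers are homogeneous (each local objective equals $F$). At iteration $k\ge1$ worker $i$ queries a stochastic gradient oracle $g_k^i(\cdot)$ (mini-batch size $b$) with $\mathbb{E}[g_k^i(w)]=\nabla F(w)$. Compression operators $\mathcal{C}_{\mathrm{up}},\mathcal{C}_{\mathrm{dwn}}$ are random maps $\mathbb{R}^d\to\mathbb{R}^d$, each call using fresh independent randomness. Algorithm \texttt{MCM} (homogeneous, no uplink memory), step $\gamma$, downlink rate $\alpha_{\mathrm{dwn}}$: $w_0$ given, $H_{-1}=w_0$, $\widehat w_0=w_0$; for $k\ge1$: $w_k=w_{k-1}-\gamma\frac1N\sum_{i=1}^N\mathcal{C}_{\mathrm{up}}(g_k^i(\widehat w_{k-1}))$; $\Omega_k=w_k-H_{k-1}$; $\widehat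 w_k=H_{k-1}+\mathcal{C}_{\mathrm{dwn}}(\Omega_k)$; $H_k=H_{k-1}+\alpha_{\mathrm{dwn}}\mathcal{C}_{\mathrm{dwn}}(\Omega_k)$ (same realization). $\Upsilon_k=\|w_k-H_{k-1}\|^2$. (A1) for some $\omega_{\mathrm{up}},\omega_{\mathrm{dwn}}>0$, all $w$: $\mathbb{E}[\mathcal{C}_{\mathrm{up/dwn}}(w)]=w$, $\mathbb{E}\|\mathcal{C}_{\mathrm{up/dwn}}(w)-w\|^2\le\omega_{\mathrm{up/dwn}}\|w\|^2$. (A2) $F$ twice continuously differentiable and $L$-smooth. (A4) $\mathbb{E}\|g_k^i(w)-\nabla F(w)\|^2\le\sigma^2/b$ for all $k,i,w$.
   Formalization: The downlink rate is additionally assumed to satisfy 0 < α_dwn ≤ 1; without an upper bound the claim fails (e.g. identity compressors, ω_dwn = 1/40, α_dwn = 5). H_0 is taken to be w_0. *)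

(* Defs.v *)
From HB Require Import structures.
From mathcomp Require Import all_boot all_order all_algebra.
From mathcomp Require Import all_classical all_reals all_analysis.
Set Implicit Arguments.
Unset Strict Implicit.
Unset Printing Implicit Defensive.
Import Order.TTheory GRing.Theory Num.Theory.
Import numFieldNormedType.Exports.
Local Open Scope classical_set_scope.
Local Open Scope ring_scope.

Section MCMDefs.
Variable R : realType.

Definition sqnorm d (x : 'rV[R]_d) : R := \sum_(j < d) x 0 j ^+ 2.
Definition enorm d (x : 'rV[R]_d) : R := Num.sqrt (sqnorm x).

Definition unitv d (j : 'I_d) : 'rV[R]_d := delta_mx 0 j.
Definition partial d (j : 'I_d) (f : 'rV[R]_d -> R) (x : 'rV[R]_d) : R :=
  'D_(unitv j) f x.
Definition grad d (f : 'rV[R]_d -> R) (x : 'rV[R]_d) : 'rV[R]_d :=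
  \row_j partial j f x.

Definition twice_cont_diff d (f : 'rV[R]_d -> R) : Prop :=
  [/\ (forall x : 'rV[R]_d, continuous_at x f),
      (forall x j, derivable f x (unitv j)),
      (forall i (x : 'rV[R]_d), continuous_at x (partial i f)),
      (forall x i j, derivable (partial i f) x (unitv j)) &
      (forall i j (x : 'rV[R]_d), continuous_at x (partial j (partial i f)))].

Definition L_smooth d (L : R) (f : 'rV[R]_d -> R) : Prop :=
  forall x y, enorm (grad f x - grad f y) <= L * enorm (x - y).

(** Measurability of a "random map" (x, s) |-> M x s : R^d -> S -> R^d,
    jointly in (x, s), with R^d carrying its Borel (product) sigma-algebra,
    through the identification of d-tuples with row vectors. *)
Definition vec_of_tuple d (t : d.-tuple R) : 'rV[R]_d := \row_j tnth t j.

Definition jmeasurable_map d (ds : measure_display) (S : measurableType ds)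
    (M : 'rV[R]_d -> S -> 'rV[R]_d) : Prop :=
  forall j : 'I_d,
    measurable_fun setT (fun p : (d.-tuple R * S)%type =>
                           M (vec_of_tuple p.1) p.2 0 j).

Definition mutually_independent_events (dO : measure_display)
    (Om : measurableType dO) (P : probability Om R) (I : eqType)
    (E : I -> set Om) : Prop :=
  forall J : seq I, uniq J ->
    P (\bigcap_(j in [set` J]) E j) = (\prod_(j <- J) P (E j))%E.

(** Mutual independence of the whole family of sources of randomness of the
    algorithm: oracle noises zeta k i, uplink compression seeds u k i and
    downlink compression seeds v k (k iteration, i worker). *)
Definition mutually_independent_seeds (dO : measure_display)
    (Om : measurableType dO) (P : probability Om R) (N : nat)
    (dz du dv : measure_display) (Z : measurableType dz)
    (U : measurableType du) (V : measurableType dv)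
    (zeta : nat -> 'I_N -> Om -> Z) (u : nat -> 'I_N -> Om -> U)
    (v : nat -> Om -> V) : Prop :=
  forall (Az : nat -> 'I_N -> set Z) (Au : nat -> 'I_N -> set U)
         (Av : nat -> set V),
    (forall k i, measurable (Az k i)) ->
    (forall k i, measurable (Au k i)) ->
    (forall k, measurable (Av k)) ->
    mutually_independent_events P
      (fun j : ((nat * 'I_N) + (nat * 'I_N) + nat)%type =>
         match j with
         | inl (inl (k, i)) => zeta k i @^-1` Az k i
         | inl (inr (k, i)) => u k i @^-1` Au k i
         | inr k => v k @^-1` Av k
         end).

(** The homogeneous MCM iterates.  mcm_state k om = (w_k, H_{k-1}, H_k, what_k)
    with the conventions H_{-1} = H_0 = what_0 = w_0. *)
Fixpoint mcm_state (dO : measure_display) (Om : measurableType dO)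
    (d N : nat) (dz du dv : measure_display) (Z : measurableType dz)
    (U : measurableType du) (V : measurableType dv)
    (g : nat -> 'I_N -> 'rV[R]_d -> Z -> 'rV[R]_d)
    (Cup : 'rV[R]_d -> U -> 'rV[R]_d) (Cdwn : 'rV[R]_d -> V -> 'rV[R]_d)
    (zeta : nat -> 'I_N -> Om -> Z) (u : nat -> 'I_N -> Om -> U)
    (v : nat -> Om -> V) (gamma alpha : R) (w0 : 'rV[R]_d) (k : nat)
    (om : Om) : 'rV[R]_d * 'rV[R]_d * 'rV[R]_d * 'rV[R]_d :=
  match k with
  | 0 => (w0, w0, w0, w0)
  | k'.+1 =>
    let: (w, _, H, wh) :=
      mcm_state g Cup Cdwn zeta u v gamma alpha w0 k' om in
    let w' := w - (gamma / N%:R) *: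
                  \sum_(i < N) Cup (g k'.+1 i wh (zeta k'.+1 i om))
                                   (u k'.+1 i om) in
    let c := Cdwn (w' - H) (v k'.+1 om) in
    (w', H, H + alpha *: c, H + c)
  end.

Definition mcm_Upsilon (dO : measure_display) (Om : measurableType dO)
    (d N : nat) (dz du dv : measure_display) (Z : measurableType dz)
    (U : measurableType du) (V : measurableType dv)
    (g : nat -> 'I_N -> 'rV[R]_d -> Z -> 'rV[R]_d)
    (Cup : 'rV[R]_d -> U -> 'rV[R]_d) (Cdwn : 'rV[R]_d -> V -> 'rV[R]_d)
    (zeta : nat -> 'I_N -> Om -> Z) (u : nat -> 'I_N -> Om -> U)
    (v : nat -> Om -> V) (gamma alpha : R) (w0 : 'rV[R]_d) (k : nat)
    (om : Om) : R :=
  let: (w, Hp, _, _) := mcm_state g Cup Cdwn zeta u v gamma alpha w0 k om in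
  sqnorm (w - Hp).

Definition mcm_what (dO : measure_display) (Om : measurableType dO)
    (d N : nat) (dz du dv : measure_display) (Z : measurableType dz)
    (U : measurableType du) (V : measurableType dv)
    (g : nat -> 'I_N -> 'rV[R]_d -> Z -> 'rV[R]_d)
    (Cup : 'rV[R]_d -> U -> 'rV[R]_d) (Cdwn : 'rV[R]_d -> V -> 'rV[R]_d)
    (zeta : nat -> 'I_N -> Om -> Z) (u : nat -> 'I_N -> Om -> U)
    (v : nat -> Om -> V) (gamma alpha : R) (w0 : 'rV[R]_d) (k : nat)
    (om : Om) : 'rV[R]_d :=
  (mcm_state g Cup Cdwn zeta u v gamma alpha w0 k om).2.

End MCMDefs.

(* Main.v *)
Require Import Defs.
From HB Require Import structures.
From mathcomp Require Import all_boot all_order all_algebra.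
From mathcomp Require Import all_classical all_reals all_analysis.
From mathcomp Require Import measurable_realfun ring lra.
Import Order.TTheory GRing.Theory Num.Theory.
Import numFieldNormedType.Exports.
Local Open Scope classical_set_scope.
Local Open Scope ring_scope.

(** Write D for the difference w - H to the memory and G for the gradient at the
    transmitted model. The seeds drawn at each call are independent of the past,
    so their randomness may be integrated out first, with the past frozen, by
    Tonelli on nonnegative integrands. Replacing the workers' messages by their
    mean G one worker at a time, the bias-variance identity charges each of them
    c^2 (omega_up |G|^2 + (1 + omega_up) sigma^2 / b) with c = gamma / N. What
    is left is |D - gamma G|^2 <= 2 / (2 - alpha) |D|^2 + 2 / alpha gamma^2 |G|^2
    (Young), and the same identity applied to the downlink compression gives
    E |D|^2 <= ((1 - alpha)^2 + alpha^2 omega_dwn) E Upsilon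
            <= (1 - alpha / 2)^2 E Upsilon. *)

(** Bundled form, required to speak of the law [distribution P f]. *)
Definition mfun_of_measurable {d1 d2 : measure_display}
    {T1 : measurableType d1} {T2 : measurableType d2} {f : T1 -> T2}
    (mf : measurable_fun setT f) : {mfun T1 >-> T2} :=
  HB.pack f (isMeasurableFun.Build _ _ _ _ f mf).

(** * Independence of a random state from the seeds not yet drawn *)

Section Independence.
Context {R : realType} {dO : measure_display} {Om : measurableType dO}.
Context {I : choiceType}.
Variables (P : probability Om R) (Fam : I -> set_system Om).
Hypothesis FamM : forall i A, Fam i A -> measurable A.

(* [Fam i] is the class of events decided by the [i]-th source of randomness,
   [S] the set of sources that [X] may depend on. *)
Definition independent_outside {dT : measure_display} {T : measurableType dT}
    (X : Om -> T) (S : set I) : Prop :=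
  measurable_fun setT X /\
  forall (A : set T) (E : I -> set Om) (J : seq I), measurable A ->
    (forall i, Fam i (E i)) -> uniq J -> (forall i, i \in J -> ~ S i) ->
    P (X @^-1` A `&` \bigcap_(i in [set` J]) E i) =
      (P (X @^-1` A) * \prod_(i <- J) P (E i))%E.

Lemma measurable_preimageT {d1 d2 : measure_display}
    {T1 : measurableType d1} {T2 : measurableType d2} {f : T1 -> T2} {A} :
  measurable_fun setT f -> measurable A -> measurable (f @^-1` A).
Proof. by move=> mf mA; rewrite -[X in measurable X]setTI; exact: mf. Qed.

Lemma independent_outside_cst {dT} {T : measurableType dT} (t : T) (S : set I) :
  (forall E, (forall i, Fam i (E i)) -> mutually_independent_events P E) ->
  independent_outside (fun=> t) S.
Proof.
move=> indE; split=> [|A E J mA FE uJ _]; first exact: measurable_cst.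
rewrite preimage_cst; case: ifPn => _; last by rewrite set0I measure0 mul0e.
by rewrite setTI probability_setT mul1e (indE _ FE _ uJ).
Qed.

Lemma independent_outside_comp {dT dT'} {T : measurableType dT}
    {T' : measurableType dT'} (X : Om -> T) (f : T -> T') (S : set I) :
  measurable_fun setT f -> independent_outside X S ->
  independent_outside (f \o X) S.
Proof.
move=> mf [mX iX]; split=> [|A E J mA FE uJ JS]; first exact: measurableT_comp.
by rewrite comp_preimage iX//; exact: measurable_preimageT.
Qed.

Lemma independent_outside_sub {dT} {T : measurableType dT}
    (X : Om -> T) (S S' : set I) :
  S `<=` S' -> independent_outside X S -> independent_outside X S'.
Proof.
by move=> SS' [mX iX]; split=> // A E J mA FE uJ JS; apply: iX => // i /JS /[swap] /SS'.
Qed.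

Context {dT dY : measure_display} {T : measurableType dT}
  {Y : measurableType dY}.
Variables (X : Om -> T) (s : Om -> Y) (S : set I) (j : I).
Hypotheses (ms : measurable_fun setT s)
  (sj : forall B, measurable B -> Fam j (s @^-1` B))
  (Sj : ~ S j) (Fam_inhab : forall i, Fam i setT) (iX : independent_outside X S).

(** The event of the fresh seed [s] enters the family [E] at the place [j], which lies outside [S],
    so the independence of [X] covers it as well. *)
Let indep2 (A : set T) (B : set Y) (E : I -> set Om) (J : seq I) :
  measurable A -> measurable B ->
  (forall i, Fam i (E i)) -> uniq J -> (forall i, i \in J -> ~ (S i \/ i = j)) ->
  P (X @^-1` A `&` s @^-1` B `&` \bigcap_(i in [set` J]) E i) =
    (P (X @^-1` A) * P (s @^-1` B) * \prod_(i <- J) P (E i))%E.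
Proof.
move=> mA mB FE uJ JS; have [mX iX'] := iX.
pose E' i := if i == j then s @^-1` B else E i.
have jJ : j \notin J by apply/negP => /JS; apply; right.
have JE' i : i \in J -> E' i = E i.
  by rewrite /E'; case: eqP => // -> jJ'; rewrite jJ' in jJ.
have := iX' A E' (j :: J) mA.
rewrite bigcap_seq !big_cons -bigcap_seq.
have -> : \bigcap_(i in [set` J]) E' i = \bigcap_(i in [set` J]) E i.
  by apply: eq_bigcapr => i iJ; exact: JE'.
rewrite (eq_big_seq (fun i => P (E i))) => [|i /JE' ->//].
have -> : E' j = s @^-1` B by rewrite /E' eqxx.
rewrite setIA muleA; apply.
- by rewrite /E' => i; case: eqP => [->|_]//; exact: sj.
- by rewrite /= jJ.
- by move=> i; rewrite inE => /orP[/eqP->//|/JS iS Si]; apply: iS; left.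
Qed.

Let indep1 (A : set T) (B : set Y) : measurable A -> measurable B ->
  P (X @^-1` A `&` s @^-1` B) = (P (X @^-1` A) * P (s @^-1` B))%E.
Proof.
move=> mA mB; have := @indep2 A B (fun=> setT) [::] mA mB.
by rewrite classical_sets.set_nil bigcap_set0 setIT big_nil mule1; exact.
Qed.

Let mXs : measurable_fun setT (fun om => (X om, s om)).
Proof. by apply/measurable_fun_pairP; split=> //; exact: iX.1. Qed.

(** Adjoining one fresh seed [j] to the past keeps it independent of the remaining ones. The seed
    events of [J] are gathered in one event [C]; as functions of [A], both sides are then finite
    measures that agree on rectangles, a generating pi-system, hence everywhere. *)
Lemma independent_outside_pair :
  independent_outside (fun om => (X om, s om)) (S `|` [set j]).
Proof.
split=> // A E J mA FE uJ JS.
set C := \bigcap_(i in _) _.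
have mC : measurable C.
  by apply: fin_bigcap_measurable => // i _; exact: FamM (FE i).
have PC : P C = (\prod_(i <- J) P (E i))%E.
  have := @indep2 setT setT E J measurableT measurableT FE uJ JS.
  by rewrite !preimage_setT !setTI !probability_setT !mul1e.
pose Xs := mfun_of_measurable mXs.
have PC0 : 0 <= fine (P C) by rewrite fine_ge0.
pose m1' : {measure set _ -> \bar R} :=
  pushforward (mrestr P mC) Xs.
pose m1 := m1' mXs.
pose m2 : {measure set _ -> \bar R} :=
  mscale (NngNum PC0) (distribution P Xs).
rewrite -PC muleC.
have -> : (P C * P ((fun om => (X om, s om)) @^-1` A))%E = m2 A.
  by rewrite /m2/= /mscale/= fineK// fin_num_measure.
transitivity (m1 A) => //.
apply: (measure_unique [set A1 `*` A2 | A1 in measurable & A2 in measurable]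
  (fun=> setT)) => //.
- exact: measurable_prod_measurableType.
- move=> _ _ [A1 mA1 [A2 mA2 <-]] [B1 mB1 [B2 mB2 <-]].
  exists (A1 `&` B1); first exact: measurableI.
  exists (A2 `&` B2); first exact: measurableI.
  by rewrite setXI.
- by move=> _; exists setT => //; exists setT => //; rewrite setXTT.
- by rewrite bigcup_const//; exists 0%N.
- move=> _ [A1 mA1 [A2 mA2 <-]].
  rewrite /m1 /m2 /= /mscale /pushforward /mrestr /distribution /pushforward/=.
  rewrite fineK ?fin_num_measure//.
  rewrite [LHS]indep2// -PC muleC; congr (_ * _)%E.
  by rewrite -indep1.
- move=> _; rewrite /m1/= /pushforward /mrestr preimage_setT setTI.
  by rewrite ltey_eq fin_num_measure.
Qed.

(** Independence makes the law of the pair the product of the laws of [X] and [s], and Tonelli then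
    integrates over the seed with [X] frozen. *)
Lemma integral_independent_pair (f : (T * Y)%type -> \bar R) :
  measurable_fun setT f -> (forall x, 0 <= f x)%E ->
  (\int[P]_om f (X om, s om) =
   \int[P]_om \int[P]_om' f (X om, s om'))%E.
Proof.
move=> mf f0; have [mX _] := iX.
pose Xs := mfun_of_measurable mXs.
pose X' := mfun_of_measurable mX.
pose s' := mfun_of_measurable ms.
transitivity (\int[distribution P Xs]_z f z)%E.
  by rewrite ge0_integral_distribution.
rewrite (eq_measure_integral (distribution P X' \x distribution P s')%E); last first.
  move=> A mA _; symmetry.
  apply: (@product_measure_unique _ _ _ _ _ (distribution P X')
     (distribution P s') (distribution P Xs)) => // A1 A2 mA1 mA2.
rewrite fubini_tonelli1// ge0_integral_distribution//.
- apply: eq_integral => om _ /=; rewrite /fubini_F ge0_integral_distribution//.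
  exact: measurable_fun_pair2.
- exact: measurable_fun_fubini_tonelli_F.
- by move=> x; exact: integral_ge0.
Qed.

(** The form used below: a bound [h] on the mean over the seed at a frozen past may be integrated
    over the past. *)
Lemma integral_independent_pair_le (f : (T * Y)%type -> \bar R) (h : T -> \bar R) :
  measurable_fun setT f -> (forall x, 0 <= f x)%E -> measurable_fun setT h ->
  (forall x, \int[P]_om f (x, s om) <= h x)%E ->
  (\int[P]_om f (X om, s om) <= \int[P]_om h (X om))%E.
Proof.
move=> mf f0 mh fh; have [mX _] := iX; rewrite integral_independent_pair//.
apply: ge0_le_integral => //.
- by move=> om _; exact: integral_ge0.
- apply: (@measurableT_comp _ _ _ _ _ _
    (fun x => \int[P]_om' f (x, s om'))%E) => //.
  apply: (measurable_fun_fubini_tonelli_F (fun p => f (p.1, s p.2))) => //.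
  apply: measurableT_comp => //; apply: measurable_fun_pair => //.
  exact: measurableT_comp.
- exact: measurableT_comp.
Qed.

End Independence.

(** * Algebra of the squared Euclidean norm *)

Section SquaredNorm.
Context {R : realType} {d : nat}.
Implicit Types x y : 'rV[R]_d.

Lemma sqnorm_ge0 x : 0 <= sqnorm x.
Proof. by apply: sumr_ge0 => j _; exact: sqr_ge0. Qed.

Lemma sqnorm0 : sqnorm (0 : 'rV[R]_d) = 0.
Proof. by apply: big1 => j _; rewrite mxE expr0n. Qed.

Lemma sqnormZ (c : R) x : sqnorm (c *: x) = c ^+ 2 * sqnorm x.
Proof. by rewrite /sqnorm mulr_sumr; apply: eq_bigr => j _; rewrite mxE exprMn. Qed.

Lemma sqnormBZ (c : R) x y :
  sqnorm (x - c *: y) =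
    sqnorm x + ((- 2 * c) * (\sum_(j < d) x 0 j * y 0 j) + c ^+ 2 * sqnorm y).
Proof.
rewrite /sqnorm !mulr_sumr -!big_split /=; apply: eq_bigr => j _.
by rewrite !mxE; ring.
Qed.

(** The weights [2 / (2 - a)] and [2 / a] have reciprocals of sum 1, so the two sides differ, in
    each coordinate, by a square over [a * (2 - a)]. For [a = alpha] the first weight is the inverse
    of [1 - alpha / 2]. *)
Lemma sqnormB_young (a : R) x y : 0 < a < 2 ->
  sqnorm (x - y) <= 2 / (2 - a) * sqnorm x + 2 / a * sqnorm y.
Proof.
move=> /andP[a0 a2]; rewrite /sqnorm !mulr_sumr -big_split /=.
apply: ler_sum => j _; rewrite !mxE.
set p := x 0 j; set q := y 0 j; rewrite -subr_ge0.
have -> : 2 / (2 - a) * p ^+ 2 + 2 / a * q ^+ 2 - (p - q) ^+ 2 =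
    (a * p + (2 - a) * q) ^+ 2 / (a * (2 - a)).
  by field; apply/andP; split; lra.
by rewrite divr_ge0 ?sqr_ge0// mulr_ge0 ?ltW// subr_gt0.
Qed.

End SquaredNorm.

(** * Measurability of vector-valued maps *)

Section VectorMeasurability.
Context {R : realType} {d : nat} {dT : measure_display} {T : measurableType dT}.

Definition vmeasurable (f : T -> 'rV[R]_d) :=
  forall j, measurable_fun setT (fun t => f t 0 j).

Lemma vmeasurable_cst x : vmeasurable (fun=> x).
Proof. by move=> j; exact: measurable_cst. Qed.

Lemma vmeasurableD f g :
  vmeasurable f -> vmeasurable g -> vmeasurable (fun t => f t + g t).
Proof.
move=> mf mg j; under eq_fun do rewrite mxE.
exact: measurable_funD.
Qed.

Lemma vmeasurableZ c f : vmeasurable f -> vmeasurable (fun t => c *: f t).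
Proof. by move=> mf j; under eq_fun do rewrite mxE; exact: measurable_funM. Qed.

Lemma vmeasurableB f g :
  vmeasurable f -> vmeasurable g -> vmeasurable (fun t => f t - g t).
Proof.
move=> mf mg; under eq_fun do rewrite -scaleN1r.
exact/vmeasurableD/vmeasurableZ.
Qed.

Lemma measurable_sqnorm f :
  vmeasurable f -> measurable_fun setT (fun t => sqnorm (f t)).
Proof. by move=> mf; apply: measurable_sum => j; exact: measurable_funX. Qed.

(** Random states are stored as tuples, which carry the product sigma-algebra; [vec_of_tuple] turns
    them back into vectors. *)
Definition tuple_of_vec (x : 'rV[R]_d) : d.-tuple R := [tuple x 0 j | j < d].

Lemma tuple_of_vecK : cancel tuple_of_vec (@vec_of_tuple R d).
Proof. by move=> x; apply/rowP => j; rewrite mxE tnth_mktuple. Qed.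

Lemma measurable_tuple_of_vec f :
  vmeasurable f -> measurable_fun setT (fun t => tuple_of_vec (f t)).
Proof.
move=> mf; apply/measurable_fun_tnthP => j.
rewrite (_ : _ \o _ = fun t => f t 0 j); first exact: mf.
by apply/funext => t /=; rewrite tnth_mktuple.
Qed.

Lemma vmeasurable_jmeasurable_map {dS : measure_display} {S : measurableType dS}
    (M : 'rV[R]_d -> S -> 'rV[R]_d) f (s : T -> S) :
  jmeasurable_map M -> vmeasurable f -> measurable_fun setT s ->
  vmeasurable (fun t => M (f t) (s t)).
Proof.
move=> mM mf ms j.
have mfs : measurable_fun setT (fun t => (tuple_of_vec (f t), s t)).
  by apply: measurable_fun_pair => //; exact: measurable_tuple_of_vec.
have := measurableT_comp (mM j) mfs.
rewrite (_ : _ \o _ = fun t => M (f t) (s t) 0 j)//.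
by apply/funext => t /=; rewrite tuple_of_vecK.
Qed.

End VectorMeasurability.

Lemma vmeasurable_vec_of_tuple {R : realType} {d : nat} {dT : measure_display}
    {T : measurableType dT} (f : T -> d.-tuple R) :
  measurable_fun setT f -> vmeasurable (fun t => vec_of_tuple (f t)).
Proof.
move=> mf j; under eq_fun do rewrite mxE.
by exact: (measurableT_comp (measurable_tnth j)).
Qed.

(* The Fubini-Tonelli measurability of parameterised integrals gives the
   measurability of the gradient without going through its continuity. *)
Lemma vmeasurable_mean {R : realType} {d : nat} {dO dS dT : measure_display}
    {Om : measurableType dO} {S : measurableType dS} {T : measurableType dT}
    (P : probability Om R) (M : 'rV[R]_d -> S -> 'rV[R]_d) (s : Om -> S)
    (G : 'rV[R]_d -> 'rV[R]_d) (f : T -> 'rV[R]_d) :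
  jmeasurable_map M -> measurable_fun setT s ->
  (forall w j, \int[P]_om (M w (s om) 0 j)%:E = (G w 0 j)%:E)%E ->
  vmeasurable f -> vmeasurable (fun t => G (f t)).
Proof.
move=> mM ms MG mf j; apply/measurable_EFinP.
pose h (p : T * Om) := (M (f p.1) (s p.2) 0 j)%:E.
have mh : measurable_fun setT h.
  apply/measurable_EFinP; apply: vmeasurable_jmeasurable_map => //.
    by move=> i; exact: (measurableT_comp (mf i)).
  exact: measurableT_comp.
(* Tonelli measurability asks for nonnegative integrands, hence the split into positive and negative
   parts. *)
rewrite (_ : _ \o _ = (fun t => \int[P]_om h^\+ (t, om) -
    \int[P]_om h^\- (t, om))%E); last first.
  apply/funext => t; rewrite /= -MG [LHS]integralE.
  by congr (_ - _)%E; apply: eq_integral => om _; rewrite ?funeposE ?funenegE.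
apply: emeasurable_funB; apply: measurable_fun_fubini_tonelli_F => //.
- exact: measurable_funepos.
- exact: measurable_funeneg.
Qed.

(** * Bias-variance inequality for a centred noise *)

Section BiasVariance.
Context {R : realType} {d : nat} {dO : measure_display} {Om : measurableType dO}.
Variables (P : probability Om R) (Y : Om -> 'rV[R]_d) (m x : 'rV[R]_d) (c B : R).
Hypotheses (mY : vmeasurable Y)
  (Ym : forall j, (\int[P]_om (Y om 0 j)%:E = (m 0 j)%:E)%E)
  (YB : (\int[P]_om (sqnorm (Y om - m))%:E <= B%:E)%E).

(** The cross term of the expanded square is linear in [Y - m] and has mean zero, so only the
    variance bound remains. The integrability of all terms comes from [YB]. *)
Lemma integral_sqnorm_bias_variance :
  (\int[P]_om (sqnorm (x - c *: (Y om - m)))%:E <= (sqnorm x + c ^+ 2 * B)%:E)%E.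
Proof.
have mYm : vmeasurable (fun om => Y om - m).
  exact/vmeasurableB/vmeasurable_cst.
have iS : P.-integrable setT (fun om => (sqnorm (Y om - m))%:E).
  apply/integrableP; split; first exact/measurable_EFinP/measurable_sqnorm.
  under eq_integral do rewrite gee0_abs ?lee_fin ?sqnorm_ge0//.
  by apply: le_lt_trans YB _; rewrite ltry.
have iD j : P.-integrable setT (fun om => ((Y om - m) 0 j)%:E).
  (* Each coordinate [z] of the noise satisfies [|z| <= 1 + z ^ 2], and constants are integrable for
     a probability. *)
  apply: (@le_integrable _ _ _ _ _ _ _
    (fun om => 1%:E + (sqnorm (Y om - m))%:E)%E) => //.
  - exact/measurable_EFinP/mYm.
  - move=> om _; rewrite -EFinD !abse_EFin lee_fin (ger0_norm (addr_ge0 _ _))//.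
      set z := (Y om - m); have zj : z 0 j ^+ 2 <= sqnorm z.
        by rewrite /sqnorm (bigD1 j)//= lerDl; apply: sumr_ge0 => i _; exact: sqr_ge0.
      apply: le_trans (lerD (lexx 1) zj).
      rewrite -real_normK ?num_real//.
      have := sqr_ge0 (`|z 0 j| - 1); have := normr_ge0 (z 0 j); nra.
    exact: sqnorm_ge0.
  - apply: integrableD => //; exact: finite_measure_integrable_cst.
have D0 j : (\int[P]_om ((Y om - m) 0 j)%:E = 0)%E.
  (* The integral of [Y - m] may be split only once [Y] is known to be integrable; it is, as an
     integrable noise plus a constant. *)
  have iY : P.-integrable setT (fun om => (Y om 0 j)%:E).
    have -> : (fun om => (Y om 0 j)%:E) =
        (fun om => ((Y om - m) 0 j)%:E + (m 0 j)%:E)%E.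
      by apply/funext => om; rewrite -EFinD !mxE subrK.
    by apply: integrableD => //; exact: finite_measure_integrable_cst.
  under eq_integral do rewrite !mxE EFinD.
  rewrite integralD//; last exact: finite_measure_integrable_cst.
  by rewrite Ym integral_cst//= probability_setT mule1 -EFinD subrr.
have iZ : P.-integrable setT
    (fun om => (\sum_(j < d) x 0 j * (Y om - m) 0 j)%:E).
  under eq_fun do rewrite -sumEFin; apply: integrable_sum => // j _.
  by under eq_fun do rewrite EFinM; exact: integrableZl.
have Z0 : (\int[P]_om (\sum_(j < d) x 0 j * (Y om - m) 0 j)%:E = 0)%E.
  under eq_integral do rewrite -sumEFin.
  rewrite integral_sum//; last first.
    by move=> j; under eq_fun do rewrite EFinM; exact: integrableZl.
  apply: big1 => j _; under eq_integral do rewrite EFinM.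
  by rewrite integralZl// D0 mule0.
rewrite (eq_integral (fun om => (sqnorm x)%:E +
    ((- 2 * c)%:E * (\sum_(j < d) x 0 j * (Y om - m) 0 j)%:E +
     (c ^+ 2)%:E * (sqnorm (Y om - m))%:E))%E); last first.
  by move=> om _; rewrite sqnormBZ -!EFinM -!EFinD.
rewrite integralD//; last 2 first.
- exact: finite_measure_integrable_cst.
- by apply: integrableD => //; exact: integrableZl.
rewrite integralD//; [|exact: integrableZl..].
rewrite !integralZl// Z0 mule0 add0e integral_cst//= probability_setT mule1.
rewrite [leRHS]EFinD [X in (_ <= _ + X)%E]EFinM leeD2l//.
apply: lee_pmul => //; first by rewrite lee_fin sqr_ge0.
by apply: integral_ge0 => om _; rewrite lee_fin sqnorm_ge0.
Qed.

End BiasVariance.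

(** * Integrating out one fresh source of randomness *)

Section OneStep.
Context {R : realType} {dO : measure_display} {Om : measurableType dO}.
Context {I : choiceType}.
Variables (P : probability Om R) (Fam : I -> set_system Om).
Hypothesis FamT : forall i, Fam i setT.
Context {d : nat} {dT dY dZ : measure_display} {T : measurableType dT}
  {Y : measurableType dY} {Z : measurableType dZ}.
Variables (X : Om -> T) (S : set I).
Hypothesis iX : independent_outside P Fam X S.
Variables (C : 'rV[R]_d -> Y -> 'rV[R]_d) (y : Om -> Y) (omega : R) (j : I).
Hypotheses (mC : jmeasurable_map C) (my : measurable_fun setT y)
  (yj : forall B, measurable B -> Fam j (y @^-1` B)) (Sj : ~ S j)
  (C_unb : forall w i, (\int[P]_om (C w (y om) 0 i)%:E = (w 0 i)%:E)%E)
  (C_var : forall w, (\int[P]_om (sqnorm (C w (y om) - w))%:E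
     <= (omega * sqnorm w)%:E)%E).

(** With [X] frozen this is the bias-variance inequality for the compressor, whose variance is at
    most [omega] times the squared norm of its input. *)
Lemma integral_fresh_compression_le (x h : T -> 'rV[R]_d) (c : R) :
  vmeasurable x -> vmeasurable h ->
  (\int[P]_om (sqnorm (x (X om) - c *: (C (h (X om)) (y om) - h (X om))))%:E <=
   \int[P]_om (sqnorm (x (X om)) + c ^+ 2 * (omega * sqnorm (h (X om))))%:E)%E.
Proof.
move=> mx mh.
apply: (@integral_independent_pair_le _ _ _ _ P Fam _ _ _ _ X y S j my yj Sj FamT iX
  (fun p => (sqnorm (x p.1 - c *: (C (h p.1) p.2 - h p.1)))%:E)
  (fun t => (sqnorm (x t) + c ^+ 2 * (omega * sqnorm (h t)))%:E)).
- have mx1 : vmeasurable (fun p : T * Y => x p.1).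
    by move=> i; exact: (measurableT_comp (mx i)).
  have mh1 : vmeasurable (fun p : T * Y => h p.1).
    by move=> i; exact: (measurableT_comp (mh i)).
  apply/measurable_EFinP/measurable_sqnorm/vmeasurableB => //.
  apply/vmeasurableZ/vmeasurableB => //.
  exact: vmeasurable_jmeasurable_map.
- by move=> p; rewrite lee_fin sqnorm_ge0.
- apply/measurable_EFinP/measurable_funD; first exact: measurable_sqnorm.
  by do 2 apply: measurable_funM => //; exact: measurable_sqnorm.
- move=> t.
  have mCt : vmeasurable (fun om => C (h t) (y om)).
    by apply: vmeasurable_jmeasurable_map => //; exact: vmeasurable_cst.
  exact: (integral_sqnorm_bias_variance P _ _ (x t) c _ mCt (C_unb _) (C_var _)).
Qed.

Variables (g : 'rV[R]_d -> Z -> 'rV[R]_d) (G : 'rV[R]_d -> 'rV[R]_d)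
  (z : Om -> Z) (V : R) (j' : I).
Hypotheses (mg : jmeasurable_map g) (mz : measurable_fun setT z)
  (zj : forall B, measurable B -> Fam j' (z @^-1` B)) (Sj' : ~ S j')
  (omega0 : 0 <= omega)
  (g_unb : forall w i, (\int[P]_om (g w (z om) 0 i)%:E = (G w 0 i)%:E)%E)
  (g_var : forall w, (\int[P]_om (sqnorm (g w (z om) - G w))%:E <= V%:E)%E).

(** The left-hand side is what integrating out the compression of [g] leaves. With [X] frozen, the
    first square costs [c ^ 2 * V], and the mean of [|g| ^ 2] is at most [|G| ^ 2 + V]; together
    they make up [(1 + omega) * V]. *)
Lemma integral_fresh_sqnorm_le (x h : T -> 'rV[R]_d) (c : R) :
  vmeasurable x -> vmeasurable h ->
  (\int[P]_om (sqnorm (x (X om) - c *: (g (h (X om)) (z om) - G (h (X om))))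
                + c ^+ 2 * (omega * sqnorm (g (h (X om)) (z om))))%:E <=
   \int[P]_om (sqnorm (x (X om))
      + c ^+ 2 * (omega * sqnorm (G (h (X om))) + (1 + omega) * V))%:E)%E.
Proof.
move=> mx mh.
have mG d1 (T1 : measurableType d1) (f : T1 -> 'rV[R]_d) :
    vmeasurable f -> vmeasurable (fun t => G (f t)).
  exact: (vmeasurable_mean P g z G _ mg mz g_unb).
apply: (@integral_independent_pair_le _ _ _ _ P Fam _ _ _ _ X z S j' mz zj Sj' FamT iX
  (fun p => (sqnorm (x p.1 - c *: (g (h p.1) p.2 - G (h p.1)))
      + c ^+ 2 * (omega * sqnorm (g (h p.1) p.2)))%:E)
  (fun t => (sqnorm (x t)
      + c ^+ 2 * (omega * sqnorm (G (h t)) + (1 + omega) * V))%:E)).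
- have mx1 : vmeasurable (fun p : T * Z => x p.1).
    by move=> i; exact: (measurableT_comp (mx i)).
  have mh1 : vmeasurable (fun p : T * Z => h p.1).
    by move=> i; exact: (measurableT_comp (mh i)).
  have mg1 : vmeasurable (fun p : T * Z => g (h p.1) p.2).
    exact: vmeasurable_jmeasurable_map.
  apply/measurable_EFinP/measurable_funD.
    apply/measurable_sqnorm/vmeasurableB/vmeasurableZ/vmeasurableB => //.
    exact: mG.
  by do 2 apply: measurable_funM => //; exact: measurable_sqnorm.
- by move=> p; rewrite lee_fin addr_ge0 ?sqnorm_ge0// mulr_ge0 ?sqr_ge0//
    mulr_ge0 ?sqnorm_ge0.
- apply/measurable_EFinP/measurable_funD; first exact: measurable_sqnorm.
  apply: measurable_funM => //; apply: measurable_funD => //.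
  by apply: measurable_funM => //; apply/measurable_sqnorm/mG.
- move=> t.
  have mgt : vmeasurable (fun om => g (h t) (z om)).
    by apply: vmeasurable_jmeasurable_map => //; exact: vmeasurable_cst.
  (* Here [g] is written as [G - (- 1) * (g - G)], so that the second square also falls under the
     bias-variance inequality. *)
  rewrite (eq_integral (fun om =>
      (sqnorm (x t - c *: (g (h t) (z om) - G (h t))))%:E +
      (c ^+ 2 * omega)%:E *
        (sqnorm (G (h t) - (- 1) *: (g (h t) (z om) - G (h t))))%:E)%E); last first.
    move=> om _; rewrite -EFinM -EFinD scaleN1r opprK [G (h t) + _]addrC subrK.
    by rewrite mulrA.
  have co0 : 0 <= c ^+ 2 * omega by rewrite mulr_ge0 ?sqr_ge0.
  rewrite ge0_integralD//; last 4 first.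
  + by move=> om _; rewrite lee_fin sqnorm_ge0.
  + apply/measurable_EFinP/measurable_sqnorm/vmeasurableB/vmeasurableZ/vmeasurableB => //;
      exact: vmeasurable_cst.
  + by move=> om _; rewrite mule_ge0 ?lee_fin ?sqnorm_ge0.
  + apply/measurable_EFinP/measurable_funM => //.
    apply/measurable_sqnorm/vmeasurableB/vmeasurableZ/vmeasurableB => //;
      exact: vmeasurable_cst.
  rewrite ge0_integralZl_EFin//; last 2 first.
  + by move=> om _; rewrite lee_fin sqnorm_ge0.
  + apply/measurable_EFinP/measurable_sqnorm/vmeasurableB/vmeasurableZ/vmeasurableB => //;
      exact: vmeasurable_cst.
  have b1 := @integral_sqnorm_bias_variance _ _ _ _ P _ (G (h t)) (x t) c V
    mgt (g_unb _) (g_var _).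
  have b2 := @integral_sqnorm_bias_variance _ _ _ _ P _ (G (h t)) (G (h t)) (- 1) V
    mgt (g_unb _) (g_var _).
  apply: le_trans (leeD b1 (lee_wpmul2l _ b2)) _ => //.
  by rewrite -EFinM -EFinD lee_fin le_eqVlt; apply/orP; left; apply/eqP; ring.
Qed.

End OneStep.

(** * One worker: oracle noise followed by uplink compression *)

Section OneWorker.
Context {R : realType} {dO : measure_display} {Om : measurableType dO}.
Context {I : choiceType}.
Variables (P : probability Om R) (Fam : I -> set_system Om).
Hypothesis FamM : forall i A, Fam i A -> measurable A.
Hypothesis FamT : forall i, Fam i setT.
Context {d : nat} {dT dY dZ : measure_display} {T : measurableType dT}
  {Y : measurableType dY} {Z : measurableType dZ}.
Variables (X : Om -> T) (S : set I).
Hypothesis iX : independent_outside P Fam X S.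
Variables (C : 'rV[R]_d -> Y -> 'rV[R]_d) (y : Om -> Y) (omega : R) (j : I).
Hypotheses (mC : jmeasurable_map C) (my : measurable_fun setT y)
  (yj : forall B, measurable B -> Fam j (y @^-1` B)) (Sj : ~ S j)
  (C_unb : forall w i, (\int[P]_om (C w (y om) 0 i)%:E = (w 0 i)%:E)%E)
  (C_var : forall w, (\int[P]_om (sqnorm (C w (y om) - w))%:E
     <= (omega * sqnorm w)%:E)%E).
Variables (g : 'rV[R]_d -> Z -> 'rV[R]_d) (G : 'rV[R]_d -> 'rV[R]_d)
  (z : Om -> Z) (V : R) (j' : I).
Hypotheses (mg : jmeasurable_map g) (mz : measurable_fun setT z)
  (zj : forall B, measurable B -> Fam j' (z @^-1` B)) (Sj' : ~ S j')
  (jj' : j <> j') (omega0 : 0 <= omega)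
  (g_unb : forall w i, (\int[P]_om (g w (z om) 0 i)%:E = (G w 0 i)%:E)%E)
  (g_var : forall w, (\int[P]_om (sqnorm (g w (z om) - G w))%:E <= V%:E)%E).

(** The seeds are integrated out in the reverse order of drawing: first the compression, with the
    past and the oracle seed frozen, then the oracle. In the split [C g - G = (C g - g) + (g - G)]
    each error is centred given what precedes it. *)
Lemma integral_fresh_worker_le (x h : T -> 'rV[R]_d) (c : R) :
  vmeasurable x -> vmeasurable h ->
  (\int[P]_om (sqnorm (x (X om) -
       c *: (C (g (h (X om)) (z om)) (y om) - G (h (X om)))))%:E <=
   \int[P]_om (sqnorm (x (X om))
      + c ^+ 2 * (omega * sqnorm (G (h (X om))) + (1 + omega) * V))%:E)%E.
Proof.
move=> mx mh.
have iXz := independent_outside_pair P Fam FamM _ _ _ _ mz zj Sj' FamT iX.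
have Sjz : ~ (S `|` [set j']) j by case.
have mhz : vmeasurable (fun p : T * Z => g (h p.1) p.2).
  apply: vmeasurable_jmeasurable_map => //.
  by move=> i; exact: (measurableT_comp (mh i)).
have mxz : vmeasurable (fun p : T * Z => x p.1 - c *: (g (h p.1) p.2 - G (h p.1))).
  apply/vmeasurableB/vmeasurableZ/vmeasurableB => //.
    by move=> i; exact: (measurableT_comp (mx i)).
  apply: (vmeasurable_mean P g z G _ mg mz g_unb).
  by move=> i; exact: (measurableT_comp (mh i)).
apply: le_trans (integral_fresh_sqnorm_le P Fam FamT X S iX omega g G z V
  j' mg mz zj Sj' omega0 g_unb g_var x h c mx mh).
have := integral_fresh_compression_le P Fam FamT _ _ iXz C y omega j
  mC my yj Sjz C_unb C_var _ _ c mxz mhz.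
apply: le_trans; rewrite le_eqVlt; apply/orP; left; apply/eqP.
apply: eq_integral => om _ /=; congr (sqnorm _)%:E.
by apply/rowP => i; rewrite !mxE; ring.
Qed.

End OneWorker.

(** * The seeds of the algorithm as one independent family *)

Section Seeds.
Context {R : realType} {dO : measure_display} {Om : measurableType dO}
  {N : nat} {dz du dv : measure_display} {Z : measurableType dz}
  {U : measurableType du} {V : measurableType dv}.
Variables (P : probability Om R)
  (zeta : nat -> 'I_N -> Om -> Z) (u : nat -> 'I_N -> Om -> U) (v : nat -> Om -> V).

Definition seed_index : choiceType := ((nat * 'I_N) + (nat * 'I_N) + nat)%type.

Definition seed_events (j : seed_index) : set_system Om :=
  match j with
  | inl (inl (k, i)) => [set zeta k i @^-1` A | A in measurable]
  | inl (inr (k, i)) => [set u k i @^-1` A | A in measurable]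
  | inr k => [set v k @^-1` A | A in measurable]
  end.

Lemma seed_events_measurable :
  (forall k i, measurable_fun setT (zeta k i)) ->
  (forall k i, measurable_fun setT (u k i)) ->
  (forall k, measurable_fun setT (v k)) ->
  forall j A, seed_events j A -> measurable A.
Proof.
move=> mz mu mv [[[k i]|[k i]]|k] _ [A mA <-]; exact: measurable_preimageT.
Qed.

Lemma seed_eventsT j : seed_events j setT.
Proof. by case: j => [[[k i]|[k i]]|k]; exists setT => //; rewrite preimage_setT. Qed.

(** Every event of a seed is the preimage of some measurable set; choosing one such set for each
    seed leads back to the hypothesis on preimages. *)
Lemma seed_events_independent : mutually_independent_seeds P zeta u v ->
  forall E : seed_index -> set Om, (forall j, seed_events j (E j)) ->
  mutually_independent_events P E.
Proof.
move=> ind E FE.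
have /choice[Az Azp] : forall x : nat * 'I_N, exists A : set Z,
    measurable A /\ zeta x.1 x.2 @^-1` A = E (inl (inl x)).
  by move=> [k i]; have [A mA <-] := FE (inl (inl (k, i))); exists A.
have /choice[Au Aup] : forall x : nat * 'I_N, exists A : set U,
    measurable A /\ u x.1 x.2 @^-1` A = E (inl (inr x)).
  by move=> [k i]; have [A mA <-] := FE (inl (inr (k, i))); exists A.
have /choice[Av Avp] : forall k : nat, exists A : set V,
    measurable A /\ v k @^-1` A = E (inr k).
  by move=> k; have [A mA <-] := FE (inr k); exists A.
have := ind (fun k i => Az (k, i)) (fun k i => Au (k, i)) Av
  (fun k i => (Azp (k, i)).1) (fun k i => (Aup (k, i)).1) (fun k => (Avp k).1).
congr (mutually_independent_events P _); apply/funext => -[[[k i]|[k i]]|k].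
- exact: (Azp (k, i)).2.
- exact: (Aup (k, i)).2.
- exact: (Avp k).2.
Qed.

(** All that the state after iteration [k] may depend on. *)
Definition seeds_upto (k : nat) : set seed_index := [set j |
  match j with
  | inl (inl (k', i)) | inl (inr (k', i)) => (k' <= k)%N
  | inr k' => (k' <= k)%N
  end].

(** Iteration [k.+1] under way: the workers of [s] have sent their messages, and the downlink seed
    of [k.+1] is still to be drawn. *)
Definition seeds_upto_workers (k : nat) (s : seq 'I_N) : set seed_index := [set j |
  match j with
  | inl (inl (k', i)) | inl (inr (k', i)) => (k' <= k)%N \/ k' = k.+1 /\ i \in s
  | inr k' => (k' <= k)%N
  end].

End Seeds.

(** Inserts the downlink contraction [x <= s y] into the estimate for one iteration. The integrals
    may be infinite, so distributivity rests on the signs. *)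
Lemma ereal_affine_le {R : realType} {a b n p q s : R} {x y z : \bar R} :
  0 <= a -> 0 <= b -> 0 <= n -> 0 <= p -> 0 <= q -> (0 <= z)%E ->
  (x <= s%:E * y)%E ->
  (a%:E * x + b%:E * z + n%:E * (p%:E * z + q%:E) <=
   (a * s)%:E * y + (b + n * p)%:E * z + (n * q)%:E)%E.
Proof.
move=> a0 b0 n0 p0 q0 z0 xy.
rewrite ge0_muleDr ?mule_ge0// EFinD ge0_muleDl ?lee_fin ?mulr_ge0//.
rewrite !EFinM -!muleA !addeA -!addeA; apply: leeD => //.
exact: lee_wpmul2l.
Qed.

(** * The MCM iterates and the recursion for Upsilon *)

Section MCM.
Context {R : realType} {dO : measure_display} {Om : measurableType dO}
  {d N : nat} {dz du dv : measure_display} {Z : measurableType dz}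
  {U : measurableType du} {V : measurableType dv}.
Variables (P : probability Om R)
  (g : nat -> 'I_N -> 'rV[R]_d -> Z -> 'rV[R]_d)
  (Cup : 'rV[R]_d -> U -> 'rV[R]_d) (Cdwn : 'rV[R]_d -> V -> 'rV[R]_d)
  (zeta : nat -> 'I_N -> Om -> Z) (u : nat -> 'I_N -> Om -> U)
  (v : nat -> Om -> V) (gamma alpha : R) (w0 : 'rV[R]_d).
Hypotheses
  (hmz : forall k i, measurable_fun setT (zeta k i))
  (hmu : forall k i, measurable_fun setT (u k i))
  (hmv : forall k, measurable_fun setT (v k))
  (hmg : forall k i, jmeasurable_map (g k i))
  (hmCup : jmeasurable_map Cup) (hmCdwn : jmeasurable_map Cdwn)
  (hind : mutually_independent_seeds P zeta u v).

Local Notation st := (mcm_state g Cup Cdwn zeta u v gamma alpha w0).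
Let W k om := (st k om).1.1.1.
Let Hp k om := (st k om).1.1.2.
Let H k om := (st k om).1.2.
Let Wh k om := (st k om).2.
Let up k i om := Cup (g k.+1 i (Wh k om) (zeta k.+1 i om)) (u k.+1 i om).
Let down k om := Cdwn (W k om - Hp k om) (v k om).

Lemma mcm_stateS k om :
  [/\ W k.+1 om = W k om - (gamma / N%:R) *: \sum_(i < N) up k i om,
      Hp k.+1 om = H k om,
      H k.+1 om = Hp k.+1 om + alpha *: down k.+1 om &
      Wh k.+1 om = Hp k.+1 om + down k.+1 om].
Proof.
rewrite /down /up /W /Hp /H /Wh /=.
by case: (st k om) => [[[a b] c] e].
Qed.

Let indep {dT} {T : measurableType dT} (X : Om -> T) :=
  independent_outside P (seed_events zeta u v) X.
Let FamM := seed_events_measurable zeta u v hmz hmu hmv.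
Let FamT := seed_eventsT zeta u v.
Let vec := d.-tuple R.
Let tov : 'rV[R]_d -> vec := tuple_of_vec.
Let vof : vec -> 'rV[R]_d := @vec_of_tuple R d.

(** Three snapshots, each holding enough to compute the next one from fresh seeds: after iteration
    [k], after the messages of the workers in [s], and just before the downlink compression. *)
Let post k om : vec * vec * vec := (tov (W k om), tov (H k om), tov (Wh k om)).
Let mid k s om : vec * vec * vec * vec :=
  (post k om, tov (\sum_(i <- s) up k i om)).
Let pre k om : vec * vec := (tov (W k.+1 om), tov (H k om)).

Let mproj1 : vmeasurable (fun p : vec * vec * vec * vec => vof p.1.1.1).
Proof.
apply: vmeasurable_vec_of_tuple; do 2 apply: measurableT_comp => //.
Qed.

Let mproj2 : vmeasurable (fun p : vec * vec * vec * vec => vof p.1.1.2).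
Proof.
apply: vmeasurable_vec_of_tuple; do 2 apply: measurableT_comp => //.
Qed.

Let mproj3 : vmeasurable (fun p : vec * vec * vec * vec => vof p.1.2).
Proof. by apply: vmeasurable_vec_of_tuple; apply: measurableT_comp. Qed.

Let mproj4 : vmeasurable (fun p : vec * vec * vec * vec => vof p.2).
Proof. by apply: vmeasurable_vec_of_tuple. Qed.

(** Induction on the workers: each adjoins its oracle seed, then its uplink seed, both fresh with
    respect to the messages summed so far. *)
Let indep_mid k s : indep (post k) (seeds_upto k) -> uniq s ->
  indep (mid k s) (seeds_upto_workers k s).
Proof.
move=> ipost; elim: s => [_|i s ih /= /andP[iNs us]].
  apply: (@independent_outside_sub _ _ _ _ _ _ _ _ _ (seeds_upto k)).
    by move=> [[[k' i]|[k' i]]|k'] /= ?; [left|left|].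
  rewrite (_ : mid k [::] = (fun p => (p, tov 0)) \o post k); last first.
    by apply/funext => om; rewrite /mid/= big_nil.
  by apply: independent_outside_comp => //; exact: measurable_fun_pair.
have {}ih := ih us.
pose j1 : @seed_index N := inl (inl (k.+1, i)).
pose j2 : @seed_index N := inl (inr (k.+1, i)).
have j1s : ~ seeds_upto_workers k s j1.
  by rewrite /seeds_upto_workers/= ltnn => -[//|[_]]; apply/negP.
have j2s : ~ (seeds_upto_workers k s `|` [set j1]) j2.
  by move=> [|//]; rewrite /seeds_upto_workers/= ltnn => -[//|[_]]; apply/negP.
have i1 := independent_outside_pair P _ FamM _ _ _ j1 (hmz k.+1 i)
  (fun B mB => ex_intro2 _ _ B mB erefl) j1s FamT ih.
have i2 := independent_outside_pair P _ FamM _ _ _ j2 (hmu k.+1 i)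
  (fun B mB => ex_intro2 _ _ B mB erefl) j2s FamT i1.
apply: (@independent_outside_sub _ _ _ _ _ _ _ _ _
  ((seeds_upto_workers k s `|` [set j1]) `|` [set j2])).
  move=> [[[k' i']|[k' i']]|k']; rewrite /seeds_upto_workers /=.
  - case=> [[[->|[-> i's]]|[-> ->]]|//]; [by left|right..];
      by rewrite inE ?i's ?eqxx ?orbT.
  - case=> [[[->|[-> i's]]|//]|[-> ->]]; [by left|right..];
      by rewrite inE ?i's ?eqxx ?orbT.
  - by case=> [[|//]|//].
(* The new message is computed from the stored model [Wh k] and the two seeds just adjoined, then
   added to the partial sum. *)
pose f (q : vec * vec * vec * vec * Z * U) : vec * vec * vec * vec :=
  (q.1.1.1, tov (Cup (g k.+1 i (vof q.1.1.1.2) q.1.2) q.2 + vof q.1.1.2)).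
rewrite (_ : mid k (i :: s) =
    f \o (fun om => (mid k s om, zeta k.+1 i om, u k.+1 i om))); last first.
  apply/funext => om; rewrite /f /mid /= /vof /tov !tuple_of_vecK big_cons.
  by [].
apply: independent_outside_comp => //.
have mq : measurable_fun setT (fun q : vec * vec * vec * vec * Z * U => q.1.1).
  exact: measurableT_comp.
have mqz : measurable_fun setT (fun q : vec * vec * vec * vec * Z * U => q.1.2).
  exact: measurableT_comp.
apply: measurable_fun_pair; first exact: measurableT_comp.
apply/measurable_tuple_of_vec/vmeasurableD; last first.
  by move=> l; exact: (measurableT_comp (mproj4 l)).
apply: vmeasurable_jmeasurable_map => //.
apply: vmeasurable_jmeasurable_map => //.
by move=> l; exact: (measurableT_comp (mproj3 l)).
Qed.

Let indep_pre k : indep (post k) (seeds_upto k) ->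
  indep (pre k) (seeds_upto_workers k (index_enum 'I_N)).
Proof.
move=> /indep_mid /(_ (index_enum_uniq _)) im.
rewrite (_ : pre k = (fun p : vec * vec * vec * vec =>
  (tov (vof p.1.1.1 - (gamma / N%:R) *: vof p.2), p.1.1.2)) \o
    mid k (index_enum 'I_N)); last first.
  apply/funext => om; rewrite /pre /mid/= /vof /tov !tuple_of_vecK.
  by have [-> _ _ _] := mcm_stateS k om.
apply: independent_outside_comp => //; apply: measurable_fun_pair.
  exact/measurable_tuple_of_vec/vmeasurableB/vmeasurableZ.
by do 2 apply: measurableT_comp => //.
Qed.

Let vmeas_pre1 {dT} {T : measurableType dT} (f : T -> vec * vec) :
  measurable_fun setT f -> vmeasurable (fun p => vof (f p).1).
Proof. by move=> mf; apply: vmeasurable_vec_of_tuple; exact: measurableT_comp. Qed.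

Let vmeas_pre2 {dT} {T : measurableType dT} (f : T -> vec * vec) :
  measurable_fun setT f -> vmeasurable (fun p => vof (f p).2).
Proof. by move=> mf; apply: vmeasurable_vec_of_tuple; exact: measurableT_comp. Qed.

Let seed_down_fresh k :
  ~ seeds_upto_workers k (index_enum 'I_N) (inr k.+1).
Proof. by rewrite /seeds_upto_workers/= ltnn. Qed.

(** Induction on [k] through [pre]: the downlink seed enters last, and one compressed vector updates
    both the memory and the transmitted model. *)
Let indep_post k : indep (post k) (seeds_upto k).
Proof.
elim: k => [|k /indep_pre ip].
  have -> : post 0 = fun=> (tov w0, tov w0, tov w0) by [].
  exact/independent_outside_cst/seed_events_independent.
have i1 := independent_outside_pair P _ FamM _ _ _ (inr k.+1) (hmv k.+1)
  (fun B mB => ex_intro2 _ _ B mB erefl) (seed_down_fresh k) FamT ip.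
apply: (@independent_outside_sub _ _ _ _ _ _ _ _ _
  (seeds_upto_workers k (index_enum 'I_N) `|` [set inr k.+1])).
  move=> [[[k' i']|[k' i']]|k']; rewrite /seeds_upto_workers /seeds_upto/=.
  - by case=> [[/leqW//|[-> _]]|].
  - by case=> [[/leqW//|[-> _]]|].
  - by case=> [/leqW|[->]].
pose c (q : vec * vec * V) := Cdwn (vof q.1.1 - vof q.1.2) q.2.
rewrite (_ : post k.+1 = (fun q : vec * vec * V =>
   (q.1.1, tov (vof q.1.2 + alpha *: c q), tov (vof q.1.2 + c q))) \o
   (fun om => (pre k om, v k.+1 om))); last first.
  apply/funext => om; rewrite /post /pre /c /= /vof /tov !tuple_of_vecK.
  by have [_ e -> ->] := mcm_stateS k om; rewrite /down e.
have m1 : vmeasurable (fun q : vec * vec * V => vof q.1.1) by exact: vmeas_pre1.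
have m2 : vmeasurable (fun q : vec * vec * V => vof q.1.2) by exact: vmeas_pre2.
have mc : vmeasurable c.
  by apply: vmeasurable_jmeasurable_map => //; exact: vmeasurableB.
apply: independent_outside_comp => //.
apply: measurable_fun_pair; first apply: measurable_fun_pair.
- exact: measurableT_comp.
- exact/measurable_tuple_of_vec/vmeasurableD/vmeasurableZ.
- exact/measurable_tuple_of_vec/vmeasurableD.
Qed.

Variables (omega_up omega_dwn B : R) (G : 'rV[R]_d -> 'rV[R]_d).
Hypotheses (N0 : (0 < N)%N) (omega_up0 : 0 <= omega_up) (omega_dwn0 : 0 <= omega_dwn)
  (B0 : 0 <= B)
  (hA1up_unb : forall k i w (j : 'I_d),
     (\int[P]_om (Cup w (u k i om) 0 j)%:E = (w 0 j)%:E)%E)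
  (hA1up_var : forall k i w,
     (\int[P]_om (sqnorm (Cup w (u k i om) - w))%:E
        <= (omega_up * sqnorm w)%:E)%E)
  (hA1dwn_unb : forall k w (j : 'I_d),
     (\int[P]_om (Cdwn w (v k om) 0 j)%:E = (w 0 j)%:E)%E)
  (hA1dwn_var : forall k w,
     (\int[P]_om (sqnorm (Cdwn w (v k om) - w))%:E
        <= (omega_dwn * sqnorm w)%:E)%E)
  (hA4_unb : forall k i w (j : 'I_d),
     (\int[P]_om (g k i w (zeta k i om) 0 j)%:E = (G w 0 j)%:E)%E)
  (hA4_var : forall k i w,
     (\int[P]_om (sqnorm (g k i w (zeta k i om) - G w))%:E <= B%:E)%E).

Let mG d1 (T1 : measurableType d1) (f : T1 -> 'rV[R]_d) :
  vmeasurable f -> vmeasurable (fun t => G (f t)).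
Proof.
(* As [N] is positive there is a worker, and its oracle has mean [G]. *)
pose i0 := Ordinal N0.
exact: (vmeasurable_mean P (g 0 i0) (zeta 0 i0) G f (hmg _ _) (hmz _ _) (hA4_unb _ _)).
Qed.

Let mW k : vmeasurable (W k).
Proof.
have [mp _] := indep_post k.
have -> : W k = fun om => vof (post k om).1.1.
  by apply/funext => om; rewrite /vof tuple_of_vecK.
by apply: vmeasurable_vec_of_tuple; do 2 apply: (measurableT_comp measurable_fst).
Qed.

Let mH k : vmeasurable (H k).
Proof.
have [mp _] := indep_post k.
have -> : H k = fun om => vof (post k om).1.2.
  by apply/funext => om; rewrite /vof tuple_of_vecK.
apply: vmeasurable_vec_of_tuple; apply: (measurableT_comp measurable_snd).
exact: (measurableT_comp measurable_fst mp).
Qed.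

Let mWh k : vmeasurable (Wh k).
Proof.
have [mp _] := indep_post k.
have -> : Wh k = fun om => vof (post k om).2.
  by apply/funext => om; rewrite /vof tuple_of_vecK.
apply: vmeasurable_vec_of_tuple; exact: (measurableT_comp measurable_snd mp).
Qed.

Let c := gamma / N%:R.

(* [W k.+1 - H k] with the messages of the workers outside [s] replaced by
   their mean. *)
Let D k (s : seq 'I_N) om : 'rV[R]_d :=
  (W k om - H k om - gamma *: G (Wh k om)) -
    c *: (\sum_(i <- s) up k i om - (size s)%:R *: G (Wh k om)).

(** Giving worker [i] its own message in place of the mean is one application of the one-worker
    estimate, with past [mid k s]. *)
Let integral_D_cons k i s : i \notin s -> uniq s ->
  (\int[P]_om (sqnorm (D k (i :: s) om))%:E <=
   \int[P]_om (sqnorm (D k s om) +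
     c ^+ 2 * (omega_up * sqnorm (G (Wh k om)) + (1 + omega_up) * B))%:E)%E.
Proof.
move=> iNs us; have im := indep_mid k s (indep_post k) us.
pose j1 : @seed_index N := inl (inl (k.+1, i)).
pose j2 : @seed_index N := inl (inr (k.+1, i)).
have j1s : ~ seeds_upto_workers k s j1.
  by rewrite /seeds_upto_workers/= ltnn => -[//|[_]]; apply/negP.
have j2s : ~ seeds_upto_workers k s j2.
  by rewrite /seeds_upto_workers/= ltnn => -[//|[_]]; apply/negP.
have jj : j2 <> j1 by [].
pose x (p : vec * vec * vec * vec) : 'rV[R]_d :=
  (vof p.1.1.1 - vof p.1.1.2 - gamma *: G (vof p.1.2)) -
    c *: (vof p.2 - (size s)%:R *: G (vof p.1.2)).
have mx : vmeasurable x.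
  apply: vmeasurableB.
    by apply/vmeasurableB/vmeasurableZ/mG => //; exact: vmeasurableB.
  by apply/vmeasurableZ/vmeasurableB/vmeasurableZ/mG.
have := integral_fresh_worker_le P (seed_events zeta u v) FamM FamT (mid k s)
  (seeds_upto_workers k s) im Cup (u k.+1 i) omega_up j2 hmCup (hmu _ _)
  (fun B mB => ex_intro2 _ _ B mB erefl) j2s (hA1up_unb _ _) (hA1up_var _ _)
  (g k.+1 i) G (zeta k.+1 i) B j1 (hmg _ _) (hmz _ _)
  (fun B mB => ex_intro2 _ _ B mB erefl) j1s jj omega_up0 (hA4_unb _ _)
  (hA4_var _ _) x (fun p => vof p.1.2) c mx mproj3.
have xE om : x (mid k s om) = D k s om.
  by rewrite /x /mid /post /D /= /vof /tov !tuple_of_vecK.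
have whE om : vof (mid k s om).1.2 = Wh k om by rewrite /vof tuple_of_vecK.
move=> le1.
rewrite (eq_integral (fun om => (sqnorm (x (mid k s om) -
    c *: (Cup (g k.+1 i (vof (mid k s om).1.2) (zeta k.+1 i om)) (u k.+1 i om) -
      G (vof (mid k s om).1.2))))%:E)); last first.
  move=> om _; rewrite xE whE; congr (sqnorm _)%:E.
  (* The size grows by one, so [D k (i :: s)] is [D k s] minus [c] times the centred message of
     [i]. *)
  by apply/rowP => l; rewrite /D big_cons /= -natr1 /up !mxE; ring.
apply: (le_trans le1).
rewrite (eq_integral (fun om => (sqnorm (D k s om) +
  c ^+ 2 * (omega_up * sqnorm (G (Wh k om)) + (1 + omega_up) * B))%:E)).
  exact: lexx.
by move=> om _; rewrite xE whE.
Qed.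

(** The price of restoring the randomness of one worker. *)
Let kappa k om :=
  c ^+ 2 * (omega_up * sqnorm (G (Wh k om)) + (1 + omega_up) * B).

Let mkappa k : measurable_fun setT (EFin \o kappa k).
Proof.
apply/measurable_EFinP; apply: measurable_funM => //.
apply: measurable_funD => //; apply: measurable_funM => //.
exact/measurable_sqnorm/mG.
Qed.

Let kappa_ge0 k om : 0 <= kappa k om.
Proof.
by rewrite mulr_ge0 ?sqr_ge0// addr_ge0// mulr_ge0 ?sqnorm_ge0// addr_ge0.
Qed.

Let mD k s : uniq s -> measurable_fun setT (fun om => (sqnorm (D k s om))%:E).
Proof.
move=> us; apply/measurable_EFinP/measurable_sqnorm/vmeasurableB.
  by apply/vmeasurableB/vmeasurableZ/mG => //; exact: vmeasurableB.
apply/vmeasurableZ/vmeasurableB/vmeasurableZ/mG => //.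
have [mm _] := indep_mid k s (indep_post k) us.
have -> : (fun om => \sum_(i <- s) up k i om) = fun om => vof (mid k s om).2.
  by apply/funext => om; rewrite /vof tuple_of_vecK.
by move=> l; exact: (measurableT_comp (mproj4 l) mm).
Qed.

(** Workers are restored one at a time, starting from [D k [::]], where every message is its
    mean. *)
Let integral_D k s : uniq s ->
  (\int[P]_om (sqnorm (D k s om))%:E <=
   \int[P]_om (sqnorm (D k [::] om))%:E +
     (size s)%:R%:E * \int[P]_om (kappa k om)%:E)%E.
Proof.
have K0 : (0 <= \int[P]_om (kappa k om)%:E)%E.
  by apply: integral_ge0 => om _; rewrite lee_fin.
elim: s => [_|i s ih /= /andP[iNs us]]; first by rewrite mul0e adde0.
apply: le_trans (integral_D_cons k i s iNs us) _.
rewrite (eq_integral (fun om =>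
  (sqnorm (D k s om))%:E + (kappa k om)%:E)%E); last by [].
rewrite ge0_integralD//; last 4 first.
- by move=> om _; rewrite lee_fin sqnorm_ge0.
- exact: mD.
- by move=> om _; rewrite lee_fin.
- exact: mkappa.
apply: le_trans (leeD (ih us) (lexx _)) _.
rewrite -natr1 EFinD ge0_muleDl ?lee_fin// mul1e [leRHS]addeA.
exact: lexx.
Qed.

Lemma integral_kappa k :
  (\int[P]_om (kappa k om)%:E =
   (c ^+ 2 * omega_up)%:E * \int[P]_om (sqnorm (G (Wh k om)))%:E +
   (c ^+ 2 * ((1 + omega_up) * B))%:E)%E.
Proof.
have mGk := measurable_sqnorm _ (mG _ _ _ (mWh k)).
rewrite (eq_integral (fun om => (c ^+ 2 * omega_up)%:E *
   (sqnorm (G (Wh k om)))%:E + (c ^+ 2 * ((1 + omega_up) * B))%:E)%E); last first.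
  by move=> om _; rewrite -EFinM -EFinD; congr EFin; rewrite /kappa; ring.
have co : 0 <= c ^+ 2 * omega_up by rewrite mulr_ge0 ?sqr_ge0.
have cB : 0 <= c ^+ 2 * ((1 + omega_up) * B).
  by rewrite mulr_ge0 ?sqr_ge0// mulr_ge0// addr_ge0.
rewrite ge0_integralD//; last 2 first.
- by move=> om _; rewrite mule_ge0 ?lee_fin// sqnorm_ge0.
- by apply: measurable_funeM; exact/measurable_EFinP.
rewrite ge0_integralZl_EFin//; last 2 first.
- by move=> om _; rewrite lee_fin sqnorm_ge0.
- exact/measurable_EFinP.
by rewrite integral_cst//= probability_setT mule1.
Qed.

Hypotheses (alpha0 : 0 < alpha) (alpha1 : alpha <= 1)
  (alpha_omega : alpha * omega_dwn <= 8^-1).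

(** The difference [W - H] is [1 - alpha] times [W - Hp], minus [alpha] times the compression error,
    which is centred and has a fresh seed. *)
Lemma mcm_downlink_contraction k :
  (\int[P]_om (sqnorm (W k om - H k om))%:E <=
   ((1 - alpha / 2) ^+ 2)%:E * \int[P]_om (sqnorm (W k om - Hp k om))%:E)%E.
Proof.
case: k => [|k].
  (* All iterates start at [w0], so both sides vanish at [k = 0]. *)
  have -> : (fun om => (sqnorm (W 0 om - H 0 om))%:E) = fun=> 0%E.
    by apply/funext => om; rewrite /W /H /= subrr sqnorm0.
  by rewrite integral0 mule0.
have ip := indep_pre k (indep_post k).
pose h (p : vec * vec) : 'rV[R]_d := vof p.1 - vof p.2.
have mh : vmeasurable h.
  by apply: vmeasurableB; [exact: vmeas_pre1|exact: vmeas_pre2].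
have hE om : h (pre k om) = W k.+1 om - Hp k.+1 om.
  have [_ -> _ _] := mcm_stateS k om.
  by rewrite /h /pre /= /vof /tov !tuple_of_vecK.
have le1 := integral_fresh_compression_le P (seed_events zeta u v) FamT (pre k) _ ip
  Cdwn (v k.+1) omega_dwn (inr k.+1) hmCdwn (hmv _)
  (fun B mB => ex_intro2 _ _ B mB erefl) (seed_down_fresh k) (hA1dwn_unb _)
  (hA1dwn_var _) (fun p => (1 - alpha) *: h p) h alpha (vmeasurableZ _ _ mh) mh.
have mO : measurable_fun setT (fun om => (sqnorm (W k.+1 om - Hp k.+1 om))%:E).
  apply/measurable_EFinP; under eq_fun do rewrite -hE.
  apply: measurable_sqnorm => l; exact: (measurableT_comp (mh l) ip.1).
rewrite -ge0_integralZl_EFin ?sqr_ge0//; last first.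
  by move=> om _; rewrite lee_fin sqnorm_ge0.
rewrite [leLHS](eq_integral (fun om => (sqnorm ((1 - alpha) *: h (pre k om) -
    alpha *: (Cdwn (h (pre k om)) (v k.+1 om) - h (pre k om))))%:E)); last first.
  move=> om _; congr (sqnorm _)%:E; rewrite hE.
  have [_ _ -> _] := mcm_stateS k om.
  by rewrite /down; apply/rowP => l; rewrite !mxE; ring.
apply: le_trans le1 _; apply: ge0_le_integral => //.
- by move=> om _; rewrite lee_fin addr_ge0 ?sqnorm_ge0// mulr_ge0 ?sqr_ge0//
    mulr_ge0 ?sqnorm_ge0.
- apply/measurable_EFinP; under eq_fun do rewrite hE sqnormZ.
  by apply: measurable_funD; repeat apply: measurable_funM => //;
    exact/measurable_EFinP.
- exact: measurable_funeM.
- move=> om _; rewrite hE sqnormZ -EFinM lee_fin mulrA -mulrDl ler_wpM2r ?sqnorm_ge0//.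
  have a1 : alpha ^+ 2 * omega_dwn <= alpha * 8^-1.
    by rewrite expr2 -mulrA ler_wpM2l// ltW.
  have a2 : alpha ^+ 2 <= alpha by rewrite expr2 ler_piMl// ltW.
  have -> : (1 - alpha / 2) ^+ 2 = 1 - alpha + alpha ^+ 2 / 4 by field.
  have -> : (1 - alpha) ^+ 2 = 1 - 2 * alpha + alpha ^+ 2 by ring.
  (* With [q] for [alpha ^+ 2] and [p] for [alpha ^+ 2 * omega_dwn] the claim is linear:
     [3 q / 4 + p <= 7 alpha / 8 <= alpha]. *)
  have a0 := alpha0; move: a0 a1 a2.
  move: (alpha ^+ 2) (alpha ^+ 2 * omega_dwn) => q p; lra.
Qed.

(** Slightly sharper than the final bound: only the Young term carries a factor 2. *)
Lemma mcm_Upsilon_step k :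
  (\int[P]_om (sqnorm (W k.+1 om - Hp k.+1 om))%:E <=
   (1 - alpha / 2)%:E * \int[P]_om (sqnorm (W k om - Hp k om))%:E +
   (gamma ^+ 2 * (2 / alpha + omega_up / N%:R))%:E *
     \int[P]_om (sqnorm (G (Wh k om)))%:E +
   (gamma ^+ 2 * ((1 + omega_up) * B) / N%:R)%:E)%E.
Proof.
have N0' : N%:R != 0 :> R by rewrite pnatr_eq0 -lt0n.
have iG0 : (0 <= \int[P]_om (sqnorm (G (Wh k om)))%:E)%E.
  by apply: integral_ge0 => om _; rewrite lee_fin sqnorm_ge0.
have mGk := measurable_sqnorm _ (mG _ _ _ (mWh k)).
have mWH : measurable_fun setT (fun om => sqnorm (W k om - H k om)).
  exact/measurable_sqnorm/vmeasurableB.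
(* With all [N] workers restored, [c * N = gamma] and the means cancel: [D] is exactly
   [W k.+1 - Hp k.+1], where [Hp k.+1] is [H k]. *)
rewrite [leLHS](eq_integral (fun om => (sqnorm (D k (index_enum 'I_N) om))%:E)); last first.
  move=> om _; congr (sqnorm _)%:E.
  have [-> -> _ _] := mcm_stateS k om; rewrite /D.
  have -> : size (index_enum 'I_N) = N.
    by rewrite [index_enum _]unlock -enumT size_enum_ord.
  by apply/rowP => l; rewrite !mxE /c; field.
apply: le_trans (integral_D k _ (index_enum_uniq _)) _.
have -> : size (index_enum 'I_N) = N.
    by rewrite [index_enum _]unlock -enumT size_enum_ord.
have alpha2 : 0 < 2 - alpha.
  by rewrite subr_gt0 (le_lt_trans alpha1)// ltr1n.
(* Young's inequality with [a = alpha], for [W - H] and [gamma G]; no seed of iteration [k.+1] is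
   left in it. *)
have D0 : (\int[P]_om (sqnorm (D k [::] om))%:E <=
    (2 / (2 - alpha))%:E * \int[P]_om (sqnorm (W k om - H k om))%:E +
    (2 / alpha * gamma ^+ 2)%:E * \int[P]_om (sqnorm (G (Wh k om)))%:E)%E.
  have a1 : 0 <= 2 / (2 - alpha) by rewrite divr_ge0// ltW.
  have a2 : 0 <= 2 / alpha * gamma ^+ 2 by rewrite mulr_ge0 ?sqr_ge0// divr_ge0// ltW.
  rewrite -!ge0_integralZl_EFin//; try (by move=> om _; rewrite lee_fin sqnorm_ge0);
    try exact/measurable_EFinP.
  rewrite -ge0_integralD//; try (by move=> om _; rewrite mule_ge0 ?lee_fin ?sqnorm_ge0);
    try (by apply: measurable_funeM; exact/measurable_EFinP).
  apply: ge0_le_integral => //.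
  - by move=> om _; rewrite lee_fin sqnorm_ge0.
  - exact: mD.
  - by apply: emeasurable_funD; apply: measurable_funeM; exact/measurable_EFinP.
  - move=> om _; rewrite -!EFinM -EFinD lee_fin.
    rewrite -(mulrA (2 / alpha)) -sqnormZ.
    rewrite /D big_nil scale0r subrr scaler0 subr0.
    by apply: sqnormB_young; rewrite alpha0/= -subr_gt0.
apply: le_trans (leeD D0 (lexx _)) _.
rewrite integral_kappa.
have cK : 0 <= c ^+ 2 * omega_up by rewrite mulr_ge0 ?sqr_ge0.
have a1 : 0 <= 2 / (2 - alpha) by rewrite divr_ge0// ltW.
have a2 : 0 <= 2 / alpha * gamma ^+ 2 by rewrite mulr_ge0 ?sqr_ge0// divr_ge0// ltW.
have cB : 0 <= c ^+ 2 * ((1 + omega_up) * B).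
  by rewrite mulr_ge0 ?sqr_ge0// mulr_ge0// addr_ge0.
(* The weight [2 / (2 - alpha)] cancels one of the two factors [1 - alpha / 2], and
   [N * c ^ 2 = gamma ^ 2 / N]. *)
have := ereal_affine_le a1 a2 (ler0n _ N) cK cB iG0 (mcm_downlink_contraction k).
congr (is_true (_ <= _ * _ + _ * _ + _)%E); congr EFin.
- by field; rewrite lt0r_neq0.
- by rewrite /c; field; rewrite N0' lt0r_neq0.
- by rewrite /c; field.
Qed.

End MCM.

Theorem theorem3
  (R : realType)
  (* probability space *)
  (dO : measure_display) (Om : measurableType dO) (P : probability Om R)
  (* dimension, number of workers, mini-batch size *)
  (d N b : nat) (hN : (0 < N)%N) (hb : (0 < b)%N)
  (* objective *)
  (F : 'rV[R]_d -> R) (L : R)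
  (* spaces of the randomness used by oracles / compressors *)
  (dz du dv : measure_display) (Z : measurableType dz)
  (U : measurableType du) (V : measurableType dv)
  (* stochastic gradient oracles g_k^i and compression operators *)
  (g : nat -> 'I_N -> 'rV[R]_d -> Z -> 'rV[R]_d)
  (Cup : 'rV[R]_d -> U -> 'rV[R]_d) (Cdwn : 'rV[R]_d -> V -> 'rV[R]_d)
  (* the random seeds *)
  (zeta : nat -> 'I_N -> Om -> Z) (u : nat -> 'I_N -> Om -> U)
  (v : nat -> Om -> V)
  (* parameters *)
  (omega_up omega_dwn sigma gamma alpha : R) (w0 : 'rV[R]_d)
  (* measurability of all the random objects *)
  (hmz : forall k i, measurable_fun setT (zeta k i))
  (hmu : forall k i, measurable_fun setT (u k i))
  (hmv : forall k, measurable_fun setT (v k))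
  (hmg : forall k i, jmeasurable_map (g k i))
  (hmCup : jmeasurable_map Cup) (hmCdwn : jmeasurable_map Cdwn)
  (* fresh independent randomness at each call *)
  (hind : mutually_independent_seeds P zeta u v)
  (hidu : forall k k' i i' (A : set U), measurable A ->
            P (u k i @^-1` A) = P (u k' i' @^-1` A))
  (hidv : forall k k' (A : set V), measurable A ->
            P (v k @^-1` A) = P (v k' @^-1` A))
  (* (A1) *)
  (homega_up : 0 < omega_up) (homega_dwn : 0 < omega_dwn)
  (hA1up_unb : forall k i w (j : 'I_d),
     (\int[P]_om (Cup w (u k i om) 0 j)%:E = (w 0 j)%:E)%E)
  (hA1up_var : forall k i w,
     (\int[P]_om (sqnorm (Cup w (u k i om) - w))%:E
        <= (omega_up * sqnorm w)%:E)%E)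
  (hA1dwn_unb : forall k w (j : 'I_d),
     (\int[P]_om (Cdwn w (v k om) 0 j)%:E = (w 0 j)%:E)%E)
  (hA1dwn_var : forall k w,
     (\int[P]_om (sqnorm (Cdwn w (v k om) - w))%:E
        <= (omega_dwn * sqnorm w)%:E)%E)
  (* (A2) *)
  (hL : 0 < L) (hF2 : twice_cont_diff F) (hFL : L_smooth L F)
  (* (A4) *)
  (hA4_unb : forall k i w (j : 'I_d),
     (\int[P]_om (g k i w (zeta k i om) 0 j)%:E = (grad F w 0 j)%:E)%E)
  (hA4_var : forall k i w,
     (\int[P]_om (sqnorm (g k i w (zeta k i om) - grad F w))%:E
        <= (sigma ^+ 2 / b%:R)%:E)%E)
  (* step size and downlink rate *)
  (hgamma : 0 < gamma) (hgammaL : gamma <= (8 * omega_dwn * L)^-1)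
  (halpha : 0 < alpha) (halpha1 : alpha <= 1)
  (halphaw : alpha <= (8 * omega_dwn)^-1) :
  forall k : nat, (1 <= k)%N ->
    (\int[P]_om
       (mcm_Upsilon g Cup Cdwn zeta u v gamma alpha w0 k om)%:E
     <= (1 - alpha / 2)%:E *
          \int[P]_om
            (mcm_Upsilon g Cup Cdwn zeta u v gamma alpha w0 k.-1 om)%:E
        + (2 * gamma ^+ 2 * (alpha^-1 + omega_up / N%:R))%:E *
          \int[P]_om
            (sqnorm (grad F
               (mcm_what g Cup Cdwn zeta u v gamma alpha w0 k.-1 om)))%:E
        + (2 * gamma ^+ 2 * sigma ^+ 2 * (1 + omega_up) / (N%:R * b%:R))%:E)%E.
Proof.
case=> [//|k] _.
have B0 : 0 <= sigma ^+ 2 / b%:R by rewrite divr_ge0 ?sqr_ge0.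
have aw : alpha * omega_dwn <= 8^-1.
  apply: le_trans (ler_wpM2r (ltW homega_dwn) halphaw) _.
  by rewrite invfM mulfVK// lt0r_neq0.
have N0 : 0 < N%:R :> R by rewrite ltr0n.
have UpsE k' om : mcm_Upsilon g Cup Cdwn zeta u v gamma alpha w0 k' om =
    sqnorm ((mcm_state g Cup Cdwn zeta u v gamma alpha w0 k' om).1.1.1 -
            (mcm_state g Cup Cdwn zeta u v gamma alpha w0 k' om).1.1.2).
  by rewrite /mcm_Upsilon; case: mcm_state => [[[]]].
under eq_integral do rewrite UpsE.
under [X in (_ <= _ * X + _ + _)%E]eq_integral do rewrite UpsE.
apply: le_trans (mcm_Upsilon_step P g Cup Cdwn zeta u v gamma alpha w0 hmz hmu
  hmv hmg hmCup hmCdwn hind omega_up omega_dwn (sigma ^+ 2 / b%:R) (grad F) hN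
  (ltW homega_up) (ltW homega_dwn) B0 hA1up_unb hA1up_var hA1dwn_unb hA1dwn_var hA4_unb hA4_var
  halpha halpha1 aw k) _.
(* The bound for one iteration lies below the claim by [gamma ^ 2 * omega_up / N] in the coefficient
   of the gradient and by half of the noise term. *)
apply: leeD; first apply: leeD => //.
- apply: lee_wpmul2r; first by apply: integral_ge0 => om _; rewrite lee_fin sqnorm_ge0.
  rewrite lee_fin -subr_ge0 (_ : _ - _ = gamma ^+ 2 * (omega_up / N%:R)).
    by rewrite mulr_ge0 ?sqr_ge0// divr_ge0// ltW.
  by field; rewrite !lt0r_neq0.
- rewrite lee_fin -subr_ge0 (_ : _ - _ =
    gamma ^+ 2 * ((1 + omega_up) * (sigma ^+ 2 / b%:R)) / N%:R).
    by rewrite divr_ge0 ?ler0n// mulr_ge0 ?sqr_ge0// mulr_ge0// addr_ge0// ltW.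
  by field; rewrite !lt0r_neq0 ?ltr0n.
Qed.
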